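(* If $n=3k+8$ for an integer $k\ge 4$, then \[ \overline{\mathrm{lcr}}(K_n) \le \frac{1}{9}(n-2)^2-\left\lfloor \frac{n-2}{6}\right\rfloor = k^2+4k+3-\left\lfloor \frac{k}{2}\right\rfloor. \]
   Context: A rectilinear drawing of the complete graph $K_n$ consists of $n$ points in the plane in general position (no three collinear), the vertices, with every pair of vertices joined by the straight line segment between them, the edges. Two edges cross if their segments intersect at a point that is not a common endpoint. The local crossing number of a drawing is the largest number of edges crossing any single edge of the drawing. The rectilinear local crossing number $\overline{\mathrm{lcr}}(K_n)$ is the minimum of the local crossing number over all rectilinear drawings of $K_n$. *)

(* Defs.v *)
From HB Require Import structures.
From mathcomp Require Export all_boot all_order all_algebra.
From mathcomp Require Export boolp classical_sets reals.
From mathcomp Require Import ring.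

Set Implicit Arguments.
Unset Strict Implicit.
Unset Printing Implicit Defensive.

Import Order.TTheory GRing.Theory Num.Theory.

Local Open Scope classical_set_scope.
Local Open Scope ring_scope.

Definition line (R : realType) (a v : 'rV[R]_2) : set 'rV[R]_2 :=
  [set x | exists t : R, x = a + t *: v].

Definition segment (R : realType) (p q : 'rV[R]_2) : set 'rV[R]_2 :=
  [set x | exists2 t : R, 0 <= t <= 1 & x = (1 - t) *: p + t *: q].

Definition collinear (R : realType) (p q r : 'rV[R]_2) : Prop :=
  exists a v : 'rV[R]_2,
    v != 0 /\ [/\ line a v p, line a v q & line a v r].

(* A rectilinear drawing of K_n is determined by the positions of its
   vertices.  Injectivity only matters for n = 2: for n >= 3 it follows from
   the absence of collinear triples. *)
Record drawing (R : realType) (n : nat) := Drawing {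
  pos :> 'I_n -> 'rV[R]_2;
  pos_inj : injective pos;
  pos_general : forall i j k : 'I_n, i != j -> i != k -> j != k ->
    ~ collinear (pos i) (pos j) (pos k)
}.

Definition edges (n : nat) : {set {set 'I_n}} :=
  [set e : {set 'I_n} | #|e| == 2%N]%SET.

Definition edge_segment (R : realType) (n : nat) (D : drawing R n)
    (e : {set 'I_n}) : set 'rV[R]_2 :=
  [set x | exists i j : 'I_n, e = [set i; j]%SET /\ segment (D i) (D j) x].

Definition crosses (R : realType) (n : nat) (D : drawing R n)
    (e f : {set 'I_n}) : Prop :=
  e != f /\
  exists x : 'rV[R]_2,
    [/\ edge_segment D e x, edge_segment D f x &
        ~ exists v : 'I_n, v \in e :&: f /\ x = D v].

Definition local_crossing_number (R : realType) (n : nat) (D : drawing R n)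
    : nat :=
  \max_(e in edges n) #|[set f in edges n | `[< crosses D e f >]]%SET|.

(* Points on the moment curve (t, t^2), used only to show that K_n has a
   rectilinear drawing, so that the minimum below is over a nonempty set. *)
Definition moment_point (R : realType) (n : nat) (i : 'I_n) : 'rV[R]_2 :=
  \row_(c < 2) (i : nat)%:R ^+ c.+1.

Lemma moment_point_inj (R : realType) (n : nat) :
  injective (@moment_point R n).
Proof.
move=> i j /rowP /(_ ord0); rewrite !mxE !expr1 => /eqP.
by rewrite eqr_nat => /eqP /val_inj.
Qed.

Lemma moment_point_general (R : realType) (n : nat) (i j k : 'I_n) :
  i != j -> i != k -> j != k ->
  ~ collinear (moment_point R i) (moment_point R j) (moment_point R k).
Proof.
move=> ij ik jk [a [v [_ [[s es] [t et] [u eu]]]]].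
have co (l : 'I_n) (w : R) : moment_point R l = a + w *: v ->
    (l : nat)%:R = a ord0 ord0 + w * v ord0 ord0 /\
    (l : nat)%:R ^+ 2 = a ord0 ord_max + w * v ord0 ord_max.
  by move=> /rowP e; split; [have := e ord0 | have := e ord_max];
    rewrite !mxE.
have [s1 s2] := co _ _ es; have [t1 t2] := co _ _ et.
have [u1 u2] := co _ _ eu.
pose x : R := (i : nat)%:R; pose y : R := (j : nat)%:R.
pose z : R := (k : nat)%:R.
have : (y - x) * (z ^+ 2 - x ^+ 2) - (z - x) * (y ^+ 2 - x ^+ 2) = 0.
  by rewrite /x /y /z s2 t2 u2 s1 t1 u1; ring.
have -> : (y - x) * (z ^+ 2 - x ^+ 2) - (z - x) * (y ^+ 2 - x ^+ 2)
  = (y - x) * (z - x) * (z - y) by ring.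
move/eqP; rewrite !mulf_eq0 !subr_eq0 !eqr_nat.
by rewrite !(inj_eq val_inj) (eq_sym j) !(eq_sym k)
  (negbTE ij) (negbTE ik) (negbTE jk).
Qed.

Lemma local_crossing_number_realized (R : realType) (n : nat) :
  exists m : nat,
    `[< exists D : drawing R n, local_crossing_number D = m >].
Proof.
pose D := Drawing (@moment_point_inj R n) (@moment_point_general R n).
by exists (local_crossing_number D); apply/asboolP; exists D.
Qed.

Definition rectilinear_lcr (R : realType) (n : nat) : nat :=
  ex_minn (local_crossing_number_realized R n).

(* Main.v *)
(** The drawing is a blow-up of a fixed drawing of K_20, found by a computer
    search: fourteen of its points are kept, and each of the other six is
    replaced by a cluster of about (k - 2) / 2 points on a tiny convex arc.
    The clusters lie in pairs on three arms.

    The orientation of three vertices then depends only on their sites and, for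
    vertices of a common cluster, on their order along the arc.  Two edges cross
    iff each separates the ends of the other, so the crossings of an edge are
    counted by pairs of vertex classes, where a cluster containing an end of the
    edge is split into the part before that end and the part after it.

    The resulting quadratic form in the class sizes is bounded through extreme
    size vectors, for which one part of a split cluster takes up the whole
    cluster.  The actual class sizes are convex combinations of these, so it is
    enough to bound the polarized form on pairs of extreme vectors; its values
    are quadratic polynomials in the cluster size and are compared with the
    bound coefficient by coefficient. *)

From Stdlib Require Import ZArith.
Require Import Defs.
From mathcomp Require Import all_boot all_order all_algebra.
From mathcomp Require Import boolp classical_sets reals.
From mathcomp Require Import zify ssrZ ring lra.
Import Order.TTheory GRing.Theory Num.Theory.
Local Open Scope ring_scope.

Set Implicit Arguments.
Unset Strict Implicit.
Unset Printing Implicit Defensive.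

(* The key [Z] denotes the scope of [int] in MathComp. *)
Delimit Scope Z_scope with BZ.

(** * Orientation and crossing segments *)

Section Orientation.
Variable R : realType.
Implicit Types p q r x : 'rV[R]_2.

(** Twice the signed area of the triangle, positive when [p], [q], [r] turn left. *)
Definition area p q r : R :=
  (q ord0 ord0 - p ord0 ord0) * (r ord0 ord_max - p ord0 ord_max)
  - (r ord0 ord0 - p ord0 ord0) * (q ord0 ord_max - p ord0 ord_max).

Lemma area_cycle p q r : area p q r = area q r p.
Proof. by rewrite /area; ring. Qed.

Lemma area_diag p q : area p q q = 0.
Proof. by rewrite /area; ring. Qed.

Lemma area_comb p q (t : R) r s :
  area p q ((1 - t) *: r + t *: s) = (1 - t) * area p q r + t * area p q s.
Proof. by rewrite /area !mxE; ring. Qed.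

Lemma area_segment p q x : segment p q x -> area p q x = 0.
Proof. by case=> t _ ->; rewrite area_comb area_diag area_cycle area_diag !mulr0 addr0. Qed.

Lemma collinear_area p q r : collinear p q r -> area p q r = 0.
Proof.
case=> a [v [_ [[t ->] [u ->] [w ->]]]].
by rewrite /area !mxE; ring.
Qed.

Lemma segment_sym p q x : segment p q x -> segment q p x.
Proof.
case=> t /andP[t0 t1] ->; exists (1 - t); first by apply/andP; split; lra.
by rewrite addrC; congr (_ *: _ + _); ring.
Qed.

(** [area p q] is affine along the second segment and vanishes at [x], so its nonzero end values
    have opposite signs. *)
Lemma segments_separated p q r s x :
  segment p q x -> segment r s x -> area p q r != 0 -> area p q s != 0 ->
  (0 < area p q r) != (0 < area p q s).
Proof.
move=> /area_segment + [t /andP[t0 t1] xE]; rewrite {}xE area_comb.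
set a := area p q r; set b := area p q s => ab0 a0 b0.
apply/eqP => sab; case: (ltrgtP 0 a) a0 sab => // a0 _; last first.
- move/esym/negbT; rewrite -leNgt => b_le0.
  have {b_le0 b0} b_lt0 : b < 0 by rewrite lt_neqAle b0.
  have [t1' | t1'] := lerP t (1 / 2).
    suff : (1 - t) * a + t * b < 0 by rewrite ab0 ltxx.
    nra.
  suff : (1 - t) * a + t * b < 0 by rewrite ab0 ltxx.
  nra.
- move/esym => b_gt0.
  suff : 0 < (1 - t) * a + t * b by rewrite ab0 ltxx.
  have [t1' | t1'] := lerP t (1 / 2); nra.
Qed.

Lemma segments_common_end p q r x :
  segment p q x -> segment p r x -> area p q r != 0 -> x = p.
Proof.
move=> /area_segment + [t _ xE]; rewrite {}xE area_comb.
rewrite (area_cycle p q p) area_diag mulr0 add0r => /eqP.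
rewrite mulf_eq0 => /orP[/eqP-> _ | -> //].
by rewrite subr0 scale1r scale0r addr0.
Qed.

End Orientation.

(** * Crossings counted through an orientation predicate *)

Section OrientedPoints.
Variables (R : realType) (T : finType) (f : T -> 'rV[R]_2).
Variable chi : T -> T -> T -> bool.
Hypothesis T_gt2 : (2 < #|T|)%N.
Hypothesis area_neq0 : forall a b c : T, a != b -> b != c -> c != a ->
  area (f a) (f b) (f c) != 0.
Hypothesis area_gt0 : forall a b c : T, a != b -> b != c -> c != a ->
  (0 < area (f a) (f b) (f c)) = chi a b c.

(** The vertex on the positive side comes first, so a crossing edge is represented in one order
    only. *)
Definition separated_pairs (a b : T) : {set T * T} :=
  [set u | [&& u.1 \notin [set a; b], u.2 \notin [set a; b],
      chi a b u.1, ~~ chi a b u.2 & chi u.1 u.2 a != chi u.1 u.2 b]]%SET.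

Let pos (i : 'I_#|T|) : 'rV[R]_2 := f (enum_val i).

(** Two coinciding points would span zero area with any third point. *)
Lemma pos_inj : injective pos.
Proof.
move=> i j fij; apply/eqP/negPn/negP => ij.
have [c] : exists c, c \in ~: [set i; j]%SET.
  apply/set0Pn; rewrite -card_gt0 cardsCs finset.setCK cards2 ij card_ord.
  by rewrite subn_gt0.
rewrite !inE negb_or => /andP[ci cj].
have : area (pos i) (pos j) (pos c) != 0.
  by apply: area_neq0; rewrite (inj_eq enum_val_inj) // eq_sym.
by rewrite fij -area_cycle area_diag eqxx.
Qed.

Lemma pos_general (i j k : 'I_#|T|) : i != j -> i != k -> j != k ->
  ~ collinear (pos i) (pos j) (pos k).
Proof.
move=> ij ik jk /collinear_area /eqP; apply/negP; apply: area_neq0;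
  by rewrite (inj_eq enum_val_inj) // eq_sym.
Qed.

Let D := Drawing pos_inj pos_general.

Lemma edge_segment_set2 (i j : 'I_#|T|) x : i != j ->
  edge_segment D [set i; j]%SET x -> segment (pos i) (pos j) x.
Proof.
move=> ij [i' [j' [/setP E s]]].
move: (E i) (E j) s; rewrite !inE !eqxx orbT => /esym/orP[]/eqP <- /esym/orP[].
- by rewrite eq_sym (negPf ij).
- by move=> /eqP <-.
- by move=> /eqP <-; apply: segment_sym.
- by rewrite eq_sym (negPf ij).
Qed.

Lemma common_end (i j k : 'I_#|T|) x : i != j -> i != k -> j != k ->
  segment (pos i) (pos j) x -> segment (pos i) (pos k) x -> x = pos i.
Proof.
move=> ij ik jk s1 s2; apply: segments_common_end s1 s2 _.
by apply: area_neq0; rewrite (inj_eq enum_val_inj) // eq_sym.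
Qed.

(** Edges sharing an end meet only at that vertex, which is excluded; disjoint edges that meet
    separate each other's ends. *)
Lemma crosses_separated (i j : 'I_#|T|) (g : {set 'I_#|T|}) : i != j ->
  g \in edges #|T| -> crosses D [set i; j]%SET g ->
  exists2 u, u \in separated_pairs (enum_val i) (enum_val j)
    & g = [set enum_rank u.1; enum_rank u.2]%SET.
Proof.
move=> ij; rewrite inE => /cards2P[k [l [kl ->]]] [ne [x [/(edge_segment_set2 ij) sij]]].
move=> /(edge_segment_set2 kl) skl nov.
have shared (a b c : 'I_#|T|) : a != b -> a != c -> b != c ->
    segment (pos a) (pos b) x -> segment (pos a) (pos c) x ->
    a \in [set i; j]%SET -> a \in [set k; l]%SET -> False.
  move=> ab ac bc sab sac ai ak; apply: nov; exists a; split.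
    by rewrite inE ai.
  exact: common_end sab sac.
have sji := segment_sym sij; have slk := segment_sym skl.
have ji : j != i by rewrite eq_sym.
have lk : l != k by rewrite eq_sym.
have ki : k != i.
  apply/eqP => E; subst k; apply: (shared i j l) => //; rewrite ?inE ?eqxx //.
  by apply: contraNneq ne => ->.
have kj : k != j.
  apply/eqP => E; subst k; apply: (shared j i l) => //; rewrite ?inE ?eqxx ?orbT //.
  by apply: contraNneq ne => ->; rewrite finset.setUC.
have li : l != i.
  apply/eqP => E; subst l; apply: (shared i j k) => //; rewrite ?inE ?eqxx ?orbT // eq_sym //.
have lj : l != j.
  apply/eqP => E; subst l; apply: (shared j i k) => //; rewrite ?inE ?eqxx ?orbT // eq_sym //.
have nz (a b c : 'I_#|T|) : a != b -> b != c -> c != a ->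
    area (pos a) (pos b) (pos c) != 0.
  by move=> *; apply: area_neq0; rewrite (inj_eq enum_val_inj).
have E (a b c : 'I_#|T|) : a != b -> b != c -> c != a ->
    (0 < area (pos a) (pos b) (pos c)) = chi (enum_val a) (enum_val b) (enum_val c).
  by move=> *; apply: area_gt0; rewrite (inj_eq enum_val_inj).
have ik : i != k by rewrite eq_sym.
have il : i != l by rewrite eq_sym.
have jk : j != k by rewrite eq_sym.
have jl : j != l by rewrite eq_sym.
(* Both orders of [k] and [l] are prepared; the side of [k] decides which one gives the pair. *)
have := segments_separated sij skl (nz i j k ij jk ki) (nz i j l ij jl li).
have := segments_separated skl sij (nz k l i kl li ik) (nz k l j kl lj jk).
have := segments_separated slk sij (nz l k i lk ki il) (nz l k j lk kj jl).
rewrite !E // => s1 s2 s3.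
case: (boolP (chi (enum_val i) (enum_val j) (enum_val k))) s3 => ck cl.
  exists (enum_val k, enum_val l); last by rewrite /= !enum_valK.
  by rewrite !inE /= !(inj_eq enum_val_inj) !negb_or ki kj li lj ck cl s2.
exists (enum_val l, enum_val k); last by rewrite /= !enum_valK finset.setUC.
rewrite !inE /= !(inj_eq enum_val_inj) !negb_or ki kj li lj ck s1.
by case: (chi _ _ _) cl.
Qed.

(** Crossing does not depend on the order of the ends, so it suffices to bound one of the two
    counts. *)
Lemma rectilinear_lcr_le (L : nat) :
  (forall a b : T, a != b ->
     (#|separated_pairs a b| <= L)%N \/ (#|separated_pairs b a| <= L)%N) ->
  (rectilinear_lcr R #|T| <= L)%N.
Proof.
move=> sepL; rewrite /rectilinear_lcr; case: ex_minnP => m _ m_min.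
apply: (@leq_trans (local_crossing_number D)).
  by apply: m_min; apply/asboolP; exists D.
apply/bigmax_leqP => e; rewrite inE => /cards2P[i [j [ij ->]]].
have bound (a b : 'I_#|T|) : a != b ->
    (#|separated_pairs (enum_val a) (enum_val b)| <= L)%N ->
    (#|[set g in edges #|T| | `[< crosses D [set a; b]%SET g >]]%SET| <= L)%N.
  move=> ab; apply: leq_trans.
  apply: leq_trans (leq_imset_card (fun u : T * T =>
    [set enum_rank u.1; enum_rank u.2]%SET) _).
  apply: subset_leq_card; apply/fintype.subsetP => g; rewrite inE => /andP[ge /asboolP c].
  by have [u u_sep ->] := crosses_separated ab ge c; apply: imset_f.
have := sepL (enum_val i) (enum_val j); rewrite (inj_eq enum_val_inj).
move=> /(_ ij)[]; first exact: bound.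
by rewrite finset.setUC; apply: bound; rewrite eq_sym.
Qed.

End OrientedPoints.

(** * The configuration *)

(* Sites 14-19 carry the clusters; they are also the only ones with a nonzero
   direction [(dx s, dy s)] of the arc. *)
Definition site_x : seq Z :=
  [:: 285; 616; 471; 800; 665; 312; 159; 405; 382; 385; 539; 772; 732; 703;
      -28; 678; -270; 547; 598; 754]%BZ.
Definition site_y : seq Z :=
  [:: -284; 40; 113; 0; 12; 384; -416; 266; -192; 304; -84; -1; -6; -15;
      800; 7; -800; -75; 53; -1]%BZ.
Definition dir_x : seq Z := ncons 14 0%BZ [:: -13; -17; 9; 7; -8; -4]%BZ.
Definition dir_y : seq Z := ncons 14 0%BZ [:: 16; 9; 8; 5; 5; -1]%BZ.

Notation sx s := (nth 0%BZ site_x s).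
Notation sy s := (nth 0%BZ site_y s).
Notation dx s := (nth 0%BZ dir_x s).
Notation dy s := (nth 0%BZ dir_y s).

Definition site_area (s t u : nat) : Z :=
  ((sx t - sx s) * (sy u - sy s) - (sx u - sx s) * (sy t - sy s))%BZ.
(** Cross product of the arc direction at [s] with the vector from [s] to [u]: its sign is the side
    of the arc's tangent on which [u] lies. *)
Definition site_side (s u : nat) : Z :=
  (dx s * (sy u - sy s) - dy s * (sx u - sx s))%BZ.

(* The predicted orientation of three vertices given as (site, index) pairs; a
   value for two equal pairs is meaningless. *)
Definition chi (a b c : nat * nat) : bool :=
  if a.1 == b.1 then
    if b.1 == c.1 then (1 < (a.2 < b.2) + (b.2 < c.2) + (c.2 < a.2))%N
    else (a.2 < b.2)%N == (0 <? site_side a.1 c.1)%BZ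
  else if b.1 == c.1 then (b.2 < c.2)%N == (0 <? site_side b.1 a.1)%BZ
  else if c.1 == a.1 then (c.2 < a.2)%N == (0 <? site_side c.1 b.1)%BZ
  else (0 <? site_area a.1 b.1 c.1)%BZ.

Lemma site_coord_bound (s : nat) :
  [/\ (Z.abs (sx s) <= 800)%BZ, (Z.abs (sy s) <= 800)%BZ,
      (Z.abs (dx s) <= 17)%BZ & (Z.abs (dy s) <= 17)%BZ].
Proof.
have [s_ge | s_lt] := leqP 20 s; first by rewrite !nth_default.
have : all (fun s => [&& (Z.abs (sx s) <=? 800)%BZ, (Z.abs (sy s) <=? 800)%BZ,
    (Z.abs (dx s) <=? 17)%BZ & (Z.abs (dy s) <=? 17)%BZ]) (iota 0 20).
  by vm_compute.
by move=> /allP/(_ s); rewrite mem_iota => /(_ s_lt)/and4P[]; split; lia.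
Qed.

Lemma site_area_neq0 (s t u : nat) : (s < 20)%N -> (t < 20)%N -> (u < 20)%N ->
  s != t -> t != u -> u != s -> site_area s t u <> 0%BZ.
Proof.
have : all (fun s => all (fun t => all (fun u =>
    [|| s == t, t == u, u == s | ~~ (site_area s t u =? 0)%BZ])
  (iota 0 20)) (iota 0 20)) (iota 0 20) by vm_compute.
move=> /allP/(_ s) + sl tl ul; rewrite mem_iota sl => /(_ isT).
move=> /allP/(_ t); rewrite mem_iota tl => /(_ isT).
move=> /allP/(_ u); rewrite mem_iota ul => /(_ isT) /or4P[] => [/eqP->|/eqP->|/eqP->|].
- by rewrite eqxx.
- by rewrite eqxx.
- by rewrite eqxx.
- by move=> /negP n _ _ _ z; apply: n; rewrite z.
Qed.

(** No tangent at a cluster passes through another site, so all vertices of that site see the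
    cluster in the same order. *)
Lemma site_side_neq0 (s u : nat) : (13 < s < 20)%N -> (u < 20)%N -> s != u ->
  site_side s u <> 0%BZ.
Proof.
have : all (fun s => all (fun u =>
    (s == u) || ~~ (site_side s u =? 0)%BZ) (iota 0 20)) (iota 14 6) by vm_compute.
move=> /allP/(_ s) + sl ul; rewrite mem_iota sl => /(_ isT).
move=> /allP/(_ u); rewrite mem_iota ul => /(_ isT) /orP[/eqP->|].
- by rewrite eqxx.
- by move=> /negP n _ z; apply: n; rewrite z.
Qed.

Lemma dir_neq0 (s : nat) : (13 < s < 20)%N -> dx s <> 0%BZ.
Proof.
have : all (fun s => ~~ (dx s =? 0)%BZ) (iota 14 6) by vm_compute.
move=> /allP/(_ s) + sl; rewrite mem_iota sl => /(_ isT).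
by move=> /negP n z; apply: n; rewrite z.
Qed.

(** * Perturbation estimates for points on the cluster arcs *)

Section Realization.
Variable R : realType.

Definition zr (z : Z) : R := (int_of_Z z)%:~R.

Lemma zrD a b : zr (a + b) = zr a + zr b.
Proof. by rewrite /zr -intrD; congr intmul; lia. Qed.
Lemma zrN a : zr (- a) = - zr a.
Proof. by rewrite /zr -intrN; congr intmul; lia. Qed.
Lemma zrB a b : zr (a - b) = zr a - zr b.
Proof. by rewrite -zrN -zrD. Qed.
Lemma zrM a b : zr (a * b) = zr a * zr b.
Proof. by rewrite /zr -intrM; congr intmul; lia. Qed.
Lemma zr_le a b : (a <= b)%BZ -> zr a <= zr b.
Proof. by move=> ab; rewrite /zr ler_int; lia. Qed.

Lemma zr_norm a (m : nat) : (Z.abs a <= Z.of_nat m)%BZ -> - m%:R <= zr a <= m%:R.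
Proof.
have -> : m%:R = zr (Z.of_nat m) by rewrite /zr (_ : int_of_Z _ = m) //; lia.
by rewrite -zrN => am; rewrite !zr_le //; lia.
Qed.

(* The quadratic term is the linear one rotated by a quarter turn, so that every
   cluster arc is strictly convex and turns to the left. *)
Definition curve (s : nat) (t : R) : 'rV[R]_2 :=
  \row_(c < 2) if c == ord0 then zr (sx s) + t * zr (dx s) - t ^+ 2 * zr (dy s)
                else zr (sy s) + t * zr (dy s) + t ^+ 2 * zr (dx s).

Lemma curve_x s t : curve s t ord0 ord0 =
  zr (sx s) + t * zr (dx s) - t ^+ 2 * zr (dy s).
Proof. by rewrite mxE. Qed.

Lemma curve_y s t : curve s t ord0 ord_max =
  zr (sy s) + t * zr (dy s) + t ^+ 2 * zr (dx s).
Proof. by rewrite mxE. Qed.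

Definition curveE := (curve_x, curve_y).

(** A Vandermonde product: only the order of the parameters affects the sign. *)
Lemma area_same_curve s t1 t2 t3 :
  area (curve s t1) (curve s t2) (curve s t3) =
  (t2 - t1) * (t3 - t2) * (t3 - t1) * (zr (dx s) ^+ 2 + zr (dy s) ^+ 2).
Proof. by rewrite /area !curveE; ring. Qed.

(* Site orientations are nonzero integers; [kappa] is small enough for the arcs to
   change them by less than 1. *)
Definition kappa : R := (100 * 100 * 100)^-1.

Lemma kappaE : kappa * (100 * 100 * 100) = 1.
Proof. by rewrite mulVf // !mulf_neq0 // pnatr_eq0. Qed.

Lemma kappa_gt0 : 0 < kappa.
Proof. by rewrite invr_gt0 !mulr_gt0 // ltr0n. Qed.

(** Turns quadratic error terms into linear ones, which linear arithmetic can handle. *)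
Lemma kappa_sqr : 0 <= kappa * kappa /\ kappa * kappa * 100 <= kappa.
Proof.
have := kappaE; have := kappa_gt0; move: kappa => k k0 kE.
split; first by rewrite mulr_ge0 ?ltW.
by rewrite -mulrA; apply: ler_piMr; rewrite ?ltW //; lra.
Qed.

Definition small (t : R) := 0 <= t <= kappa.

Lemma norm_mul_le (a b x y : R) : -a <= x <= a -> - b <= y <= b ->
  - (a * b) <= x * y <= a * b.
Proof.
rewrite -!ler_norml => xa yb; rewrite normrM.
by apply: ler_pM.
Qed.

Lemma norm_sub_le (a b m x y : R) : -a <= x <= a -> - b <= y <= b -> a + b = m ->
  - m <= x - y <= m.
Proof.
rewrite -!ler_norml => xa yb <-.
by apply: le_trans (ler_normB x y) _; apply: lerD.
Qed.

Lemma norm_add_le (a b m x y : R) : -a <= x <= a -> - b <= y <= b -> a + b = m ->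
  - m <= x + y <= m.
Proof.
rewrite -!ler_norml => xa yb <-.
by apply: le_trans (ler_normD x y) _; apply: lerD.
Qed.

(** The constant 20 covers the linear term, at most [17 * kappa], and the much smaller quadratic
    one. *)
Lemma curve_near s t : small t ->
  (- (20 * kappa) <= curve s t ord0 ord0 - zr (sx s) <= 20 * kappa) /\
  (- (20 * kappa) <= curve s t ord0 ord_max - zr (sy s) <= 20 * kappa).
Proof.
rewrite /small; have := kappaE; have := kappa_gt0; have [] := kappa_sqr.
move: kappa => k k1 k2 k3 k4 /andP[t0 t1].
have [_ _ /(@zr_norm _ 17) X /(@zr_norm _ 17) Y] := site_coord_bound s.
have T : - k <= t <= k by apply/andP; split; lra.
have /andP[? ?] := norm_mul_le T X; have /andP[? ?] := norm_mul_le T Y.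
have /andP[? ?] := norm_mul_le T (norm_mul_le T X).
have /andP[? ?] := norm_mul_le T (norm_mul_le T Y).
rewrite !curveE !expr2 -!mulrA; split; apply/andP; split; lra.
Qed.

(** Coordinate differences of sites are at most 1600, with errors at most [40 * kappa]; this bounds
    the total error by about [256000 * kappa]. *)
Lemma area_perturbed s1 s2 s3 t1 t2 t3 : small t1 -> small t2 -> small t3 ->
  - 1 < area (curve s1 t1) (curve s2 t2) (curve s3 t3) - zr (site_area s1 s2 s3) < 1.
Proof.
move=> /(curve_near s1)[] + + /(curve_near s2)[] + + /(curve_near s3)[].
rewrite /area /site_area !(zrB, zrM).
have [/(@zr_norm _ 800) X1 /(@zr_norm _ 800) Y1 _ _] := site_coord_bound s1.
have [/(@zr_norm _ 800) X2 /(@zr_norm _ 800) Y2 _ _] := site_coord_bound s2.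
have [/(@zr_norm _ 800) X3 /(@zr_norm _ 800) Y3 _ _] := site_coord_bound s3.
have := kappaE; have := kappa_gt0; have [] := kappa_sqr.
move: kappa => k k1 k2 k3 k4.
move: (zr (sx s1)) (zr (sx s2)) (zr (sx s3)) X1 X2 X3 => x1 x2 x3 X1 X2 X3.
move: (zr (sy s1)) (zr (sy s2)) (zr (sy s3)) Y1 Y2 Y3 => y1 y2 y3 Y1 Y2 Y3.
move: (curve s1 t1 ord0 ord0) (curve s2 t2 ord0 ord0) (curve s3 t3 ord0 ord0)
  (curve s1 t1 ord0 ord_max) (curve s2 t2 ord0 ord_max) (curve s3 t3 ord0 ord_max).
move=> p1 p2 p3 q1 q2 q3 A1 B1 A2 B2 A3 B3.
have h40 : 20 * k + 20 * k = 40 * k by ring.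
have h1600 : 800 + 800 = 1600 :> R by ring.
have E2 := norm_sub_le A2 A1 h40; have E3 := norm_sub_le A3 A1 h40.
have F2 := norm_sub_le B2 B1 h40; have F3 := norm_sub_le B3 B1 h40.
have U2 := norm_sub_le X2 X1 h1600; have U3 := norm_sub_le X3 X1 h1600.
have V2 := norm_sub_le Y2 Y1 h1600; have V3 := norm_sub_le Y3 Y1 h1600.
(* The error splits into two parts linear in the displacements and one quadratic part. *)
have := norm_sub_le (norm_mul_le U2 F3) (norm_mul_le U3 F2) erefl.
have := norm_sub_le (norm_mul_le E2 V3) (norm_mul_le E3 V2) erefl.
have := norm_sub_le (norm_mul_le E2 F3) (norm_mul_le E3 F2) erefl.
move=> {A1 A2 A3 B1 B2 B3 E2 E3 F2 F3 U2 U3 V2 V3 X1 X2 X3 Y1 Y2 Y3 h40 h1600}.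
set d := (X in - 1 < X < 1); set u := (X in - _ <= X <= _ -> _).
set v := (X in - _ <= X <= _ -> - 1 < _ < _ ); set w := (X in - _ <= X <= _ -> - _ <= v <= _ -> _).
have -> : d = w + v + u by rewrite /d /u /v /w; ring.
move: u v w => u v w {d} /andP[? ?] /andP[? ?] /andP[? ?]; apply/andP; split; lra.
Qed.

(** Two points of one arc nearly coincide and the area is tiny; only after extracting [t2 - t1] does
    a perturbed integer remain. *)
Lemma area_two_on_curve s u t1 t2 t3 : small t1 -> small t2 -> small t3 ->
  exists2 e, - 1 < e < 1 &
    area (curve s t1) (curve s t2) (curve u t3) = (t2 - t1) * (zr (site_side s u) + e).
Proof.
move=> s1 s2 /(curve_near u)[].
have [/(@zr_norm _ 800) X1 /(@zr_norm _ 800) Y1] := site_coord_bound s.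
move=> /(@zr_norm _ 17) D1 /(@zr_norm _ 17) D2.
have [/(@zr_norm _ 800) X2 /(@zr_norm _ 800) Y2 _ _] := site_coord_bound u.
rewrite /area /site_side !(zrB, zrM) (curve_x s) (curve_x s) !(curve_y s).
have small_norm t : small t -> - kappa <= t <= kappa.
  by have := kappa_gt0; move=> k0 /andP[? ?]; apply/andP; split; lra.
have {}s1 := small_norm _ s1; have {small_norm} s2 := small_norm _ s2.
have := kappaE; have := kappa_gt0.
have [] := kappa_sqr; move: s1 s2; move: kappa => k s1 s2 k1 k2 k3 k4.
move: (zr (sx s)) (zr (sx u)) (zr (sy s)) (zr (sy u)) (zr (dx s)) (zr (dy s))
  X1 X2 Y1 Y2 D1 D2 => x1 x2 y1 y2 d1 d2 X1 X2 Y1 Y2 D1 D2.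
move: (curve u t3 ord0 ord0) (curve u t3 ord0 ord_max) => p q A B.
(* The first line is due to the displacement of the point at [u], the others to the quadratic term
   of the arc at [s]. *)
exists (d1 * (q - y2) - d2 * (p - x2)
  - (t1 + t2) * (d2 * ((q - y2) + (y2 - y1)) + d1 * ((p - x2) + (x2 - x1)))
  + (t1 * t2) * (d1 * d1 + d2 * d2)); last by ring.
have Q1 := norm_sub_le (norm_mul_le D1 B) (norm_mul_le D2 A) erefl.
have YY := norm_add_le B (norm_sub_le Y2 Y1 erefl) erefl.
have XX := norm_add_le A (norm_sub_le X2 X1 erefl) erefl.
have Q2 := norm_mul_le (norm_add_le s1 s2 erefl)
  (norm_add_le (norm_mul_le D2 YY) (norm_mul_le D1 XX) erefl).
have Q3 := norm_mul_le (norm_mul_le s1 s2)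
  (norm_add_le (norm_mul_le D1 D1) (norm_mul_le D2 D2) erefl).
have := norm_add_le (norm_sub_le Q1 Q2 erefl) Q3 erefl.
move: (_ + (t1 * t2) * _) => e {Q1 Q2 Q3 XX YY A B X1 X2 Y1 Y2 D1 D2 s1 s2}.
by move=> /andP[? ?]; apply/andP; split; lra.
Qed.
End Realization.

(** * Orientations of the placed vertices *)

Section Signs.
Variables (R : realType) (N : nat).

Definition step : R := kappa R / N.+1%:R.
Definition place (a : nat * nat) : 'rV[R]_2 := curve a.1 (step * a.2%:R).
Definition valid (a : nat * nat) := [&& (a.1 < 20)%N, (a.2 <= N)%N & (13 < a.1)%N || (a.2 == 0)%N].

Lemma step_gt0 : 0 < step.
Proof. by rewrite /step divr_gt0 ?kappa_gt0 ?ltr0n. Qed.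

Lemma small_step i : (i <= N)%N -> small (step * i%:R).
Proof.
move=> iN; rewrite /small mulr_ge0 ?ler0n ?(ltW step_gt0) //=.
rewrite /step -mulrA ler_piMr ?(ltW (kappa_gt0 R)) //.
by rewrite mulrC ler_pdivrMr ?ltr0n // mul1r ler_nat leqW.
Qed.

Lemma zr_perturbed (e : R) z : - 1 < e < 1 -> z <> 0%BZ ->
  (zr R z + e != 0) * ((0 < zr R z + e) = (0 <? z)%BZ).
Proof.
move=> /andP[e1 e2] z0; case: Z.ltb_spec => z_sg.
  have z1 : zr R 1%BZ <= zr R z by apply: zr_le; lia.
  have : 0 < zr R z + e by rewrite /zr in z1 *; lra.
  by move=> h; rewrite h lt0r_neq0.
have z1 : zr R z <= zr R (-1)%BZ by apply: zr_le; lia.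
have h : zr R z + e < 0 by rewrite /zr in z1 *; lra.
by rewrite ltr0_neq0 // ltNge (ltW h).
Qed.

Lemma step_lt i j : (0 < step * j%:R - step * i%:R) = (i < j)%N.
Proof. by rewrite subr_gt0 ltr_pM2l ?step_gt0 // ltr_nat. Qed.

Lemma step_eq i j : (step * j%:R - step * i%:R == 0) = (i == j).
Proof.
by rewrite subr_eq0 (inj_eq (mulfI (lt0r_neq0 step_gt0))) eqr_nat eq_sym.
Qed.

Lemma mulr_gt0_eq (x y : R) : x != 0 -> y != 0 -> (0 < x * y) = ((0 < x) == (0 < y)).
Proof.
move=> x0 y0; case: (ltrgtP 0 x) x0 => // hx _.
  by rewrite pmulr_rgt0.
by rewrite nmulr_rgt0 //; case: (ltrgtP 0 y) y0.
Qed.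

Lemma area_place_same_site s u i j l : (13 < s < 20)%N -> (u < 20)%N -> s != u ->
  (i <= N)%N -> (j <= N)%N -> (l <= N)%N -> i != j ->
  (area (place (s, i)) (place (s, j)) (place (u, l)) != 0) *
  ((0 < area (place (s, i)) (place (s, j)) (place (u, l))) =
   ((i < j)%N == (0 <? site_side s u)%BZ)).
Proof.
move=> s_cl ul su iN jN lN ij; rewrite /place /=.
have [e e1 ->] := area_two_on_curve s u (small_step iN) (small_step jN) (small_step lN).
have [nz sg] := zr_perturbed e1 (site_side_neq0 s_cl ul su).
have tnz : step * j%:R - step * i%:R != 0 by rewrite step_eq.
by rewrite mulf_neq0 // mulr_gt0_eq // step_lt sg.
Qed.

(** Of the three cyclic comparisons of distinct indices one or two hold; two hold exactly when the
    Vandermonde product is positive. *)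
Lemma area_place_one_site s i j l : (13 < s < 20)%N -> i != j -> j != l -> l != i ->
  (area (place (s, i)) (place (s, j)) (place (s, l)) != 0) *
  ((0 < area (place (s, i)) (place (s, j)) (place (s, l))) =
   (1 < (i < j) + (j < l) + (l < i))%N).
Proof.
move=> s_cl ij jl li; rewrite /place /= area_same_curve.
have d0 : 0 < zr R (dx s) ^+ 2 + zr R (dy s) ^+ 2.
  have [z0 _] := @zr_perturbed 0 (dx s) ltac:(lra) (dir_neq0 s_cl).
  by rewrite ltr_wpDr ?sqr_ge0 // exprn_even_gt0 //= -[zr _ _]addr0.
rewrite pmulr_lgt0 // !mulf_neq0 ?step_eq ?(lt0r_neq0 d0) // 1?eq_sym //; split=> //.
rewrite !mulr_gt0_eq ?mulf_neq0 ?step_eq // 1?eq_sym // !step_lt.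
by case: (ltngtP i j) ij => // ? _; case: (ltngtP j l) jl => // ? _;
  case: (ltngtP l i) li => // ? _; lia.
Qed.

Lemma area_place (a b c : nat * nat) : valid a -> valid b -> valid c ->
  a != b -> b != c -> c != a ->
  (area (place a) (place b) (place c) != 0) *
  ((0 < area (place a) (place b) (place c)) = chi a b c).
Proof.
case: a b c => [s i] [t j] [u l] /and3P[/= sl iN s_cl] /and3P[/= tl jN t_cl].
move=> /and3P[/= ul lN u_cl]; rewrite /chi /= -!pair_eqE /pair_eq /=.
(* A site occurring with two distinct indices is a cluster, since the other sites carry index 0
   only. *)
have cl s' i' j' : (s' < 20)%N -> (13 < s')%N || (i' == 0)%N -> (13 < s')%N || (j' == 0)%N ->
    i' != j' -> (13 < s' < 20)%N.
  by move=> -> /orP[-> // | /eqP->] /orP[-> // | /eqP->]; rewrite eqxx.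
have [st|st] := eqVneq s t.
  subst t; have [su|su] := eqVneq s u.
    subst u => /=; rewrite ?eqxx /= => ij jl li.
    exact: area_place_one_site (cl _ _ _ sl s_cl t_cl ij) ij jl li.
  by move=> /= ij _ _; apply: area_place_same_site => //; apply: cl ij.
have [tu|tu] := eqVneq t u.
  subst u => _ /= jl _; rewrite area_cycle.
  by apply: area_place_same_site => //; [apply: cl jl | rewrite eq_sym].
have [us|us] := eqVneq u s.
  subst u => _ _ /= li; rewrite -area_cycle.
  by apply: area_place_same_site => //; apply: cl li.
move=> _ _ _; rewrite /place /=.
have := area_perturbed s t u (small_step iN) (small_step jN) (small_step lN).
move=> /zr_perturbed/(_ (site_area_neq0 sl tl ul st tu us)).
by rewrite addrC subrK.
Qed.
End Signs.

(** * Counting crossings by classes *)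

Section Counting.
Local Open Scope nat_scope.

(* Here [V k], for [k] in [I], are the extreme size vectors; [2 * Q(W) = B(W, W)]
   for the symmetric bilinear form [B] in the last hypothesis. *)
Lemma mixture_bound (K C : eqType) (E : seq (K * K)) (I : seq C)
    (lam : C -> nat) (V : C -> K -> nat) (W : K -> nat) (L : nat) :
  0 < \sum_(k <- I) lam k ->
  (forall e, e \in E ->
     (\sum_(k <- I) lam k) * W e.1 <= \sum_(k <- I) lam k * V k e.1 /\
     (\sum_(k <- I) lam k) * W e.2 <= \sum_(k <- I) lam k * V k e.2) ->
  (forall k l, k \in I -> l \in I ->
     \sum_(e <- E) (V k e.1 * V l e.2 + V l e.1 * V k e.2) <= 2 * L) ->
  \sum_(e <- E) W e.1 * W e.2 <= L.
Proof.
set A := \sum_(k <- I) lam k => A_gt0 W_le V_le.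
(* The weights are not normalized; this factor clears the denominators and allows for the doubling
   by polarization. *)
have A2 : 0 < 2 * (A * A) by rewrite !muln_gt0 A_gt0.
rewrite -(leq_pmul2l A2).
apply: (@leq_trans (\sum_(k <- I) \sum_(l <- I) lam k * lam l *
    \sum_(e <- E) (V k e.1 * V l e.2 + V l e.1 * V k e.2))); last first.
  apply: (@leq_trans (\sum_(k <- I) \sum_(l <- I) lam k * lam l * (2 * L))).
    rewrite big_seq [leqRHS]big_seq; apply: leq_sum => k kI.
    rewrite big_seq [leqRHS]big_seq; apply: leq_sum => l lI.
    by rewrite leq_mul2l V_le // orbT.
  have -> : \sum_(k <- I) \sum_(l <- I) lam k * lam l * (2 * L) = A * A * (2 * L).
    rewrite -mulnA [in RHS]/A [RHS]big_distrl /=; apply: eq_bigr => k _.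
    by rewrite -[LHS]big_distrl /= -big_distrr /= [RHS]mulnA.
  by rewrite mulnCA !mulnA.
(* The two halves of the polarized form agree after swapping [k] and [l], each giving the product of
   the mixtures. *)
have -> : \sum_(k <- I) \sum_(l <- I) lam k * lam l *
    \sum_(e <- E) (V k e.1 * V l e.2 + V l e.1 * V k e.2) =
  \sum_(e <- E) 2 * ((\sum_(k <- I) lam k * V k e.1) * (\sum_(l <- I) lam l * V l e.2)).
  transitivity (\sum_(e <- E) \sum_(k <- I) \sum_(l <- I)
      (lam k * V k e.1 * (lam l * V l e.2) + lam l * V l e.1 * (lam k * V k e.2))).
    rewrite [RHS]exchange_big /=; apply: eq_bigr => k _.
    rewrite [RHS]exchange_big /=; apply: eq_bigr => l _.
    by rewrite big_distrr /=; apply: eq_bigr => e _; lia.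
  apply: eq_bigr => e _.
  under eq_bigr do rewrite big_split /=.
  rewrite big_split /= [X in _ + X]exchange_big /= addnn -mul2n; congr (2 * _).
  by rewrite big_distrl /=; apply: eq_bigr => k _; rewrite big_distrr.
rewrite big_distrr /= big_seq [leqRHS]big_seq; apply: leq_sum => e eE.
have [W1 W2] := W_le e eE.
by rewrite -mulnA leq_mul2l /= mulnACA leq_mul.
Qed.

(** * Polynomials in the cluster parameter and the finite certificate *)

Definition form := (nat * nat)%type.
Definition evalf (u : nat) (f : form) := f.1 + f.2 * u.
Definition poly2 := (nat * nat * nat)%type.
Definition evalp (u : nat) (p : poly2) := p.1.1 + p.1.2 * u + p.2 * (u * u).
Definition addp (p q : poly2) : poly2 := (p.1.1 + q.1.1, p.1.2 + q.1.2, p.2 + q.2).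
Definition mulf (f g : form) : poly2 := (f.1 * g.1, f.1 * g.2 + f.2 * g.1, f.2 * g.2).
(** Coefficientwise comparison implies the inequality at every natural [u], so one finite check
    serves all cluster sizes. *)
Definition lep (p q : poly2) := [&& p.1.1 <= q.1.1, p.1.2 <= q.1.2 & p.2 <= q.2].

Lemma evalp_add u p q : evalp u (addp p q) = evalp u p + evalp u q.
Proof. by rewrite /evalp /=; nia. Qed.
Lemma evalp_mul u f g : evalp u (mulf f g) = evalf u f * evalf u g.
Proof. by rewrite /evalp /evalf /=; nia. Qed.
Lemma evalp_le u p q : lep p q -> evalp u p <= evalp u q.
Proof. by move=> /and3P[? ? ?]; rewrite /evalp !leq_add // leq_mul2r ?orbT //; apply/orP; right. Qed.

(* Forms are polynomials in [u], where [k = 2 * u + 4 + b] with [b] the parity of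
   [k]: clusters 14-16 have [u + 1] points, clusters 17-19 have [u + 1 + b]. *)
Definition size_form (b s : nat) : form :=
  if s < 14 then (1, 0) else if s < 17 then (1, 1) else (1 + b, 1).
(** One vertex is removed for an end of the edge. If both ends lie in the cluster, this
    overestimates the remaining vertices by one. *)
Definition room_form (b s : nat) : form :=
  ((size_form b s).1.-1, (size_form b s).2).
(* [k ^ 2 + 4 * k + 3 - k./2] for [b <= 1]. *)
Definition limit (b : nat) : poly2 := (33 + 13 * b, 23 + 4 * b, 4).

(* Nodes name the classes of vertices with respect to an edge with ends at the
   sites [s] and [t].  The second component is the rank relative to the ends in
   the same cluster: an end has rank 1, or 3 if it is the later of two ends in a
   common cluster, and the parts between have even ranks. *)
Definition nodes (s t : nat) : seq (nat * nat) :=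
  [seq (c, 0) | c <- iota 0 20 & (c != s) && (c != t)] ++
  (if s == t then [:: (s, 0); (s, 2); (s, 4)]
   else [:: (s, 0); (s, 2); (t, 0); (t, 2)]).

Definition end_nodes (s t : nat) : (nat * nat) * (nat * nat) :=
  ((s, 1), (t, if s == t then 3 else 1)).

(** The analogue of [separated_pairs] for classes. Its two classes lie on opposite sides of the
    edge, so no class is paired with itself. *)
Definition crossing_nodes (s t : nat) : seq ((nat * nat) * (nat * nat)) :=
  let p := (end_nodes s t).1 in let q := (end_nodes s t).2 in
  [seq e <- [seq (c, d) | c <- [seq c <- nodes s t | chi p q c],
                          d <- [seq d <- nodes s t | ~~ chi p q d]]
     | chi e.1 e.2 p != chi e.1 e.2 q].

(** An entry records the ranks of the parts that fill the split clusters; for [s == t] the first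
    component alone carries the rank. *)
Definition corners (s t : nat) : seq (nat * nat) :=
  if s == t then [:: (0, 0); (2, 0); (4, 0)]
  else [:: (0, 0); (0, 2); (2, 0); (2, 2)].

Definition corner_form (b s t : nat) (k : nat * nat) (c : nat * nat) : form :=
  if c.1 == s then if c.2 == k.1 then room_form b s else (0, 0)
  else if c.1 == t then if c.2 == k.2 then room_form b t else (0, 0)
  else size_form b c.1.

Definition corner_poly (b s t : nat) E (k l : nat * nat) : poly2 :=
  foldr (fun e p =>
      addp (addp (mulf (corner_form b s t k e.1) (corner_form b s t l e.2))
                 (mulf (corner_form b s t l e.1) (corner_form b s t k e.2))) p)
    (0, 0, 0) E.

Definition certified (b s t : nat) : bool :=
  let E := crossing_nodes s t in
  all (fun k => all (fun l =>
      lep (corner_poly b s t E k l) (addp (limit b) (limit b)))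
    (corners s t)) (corners s t).

(** This evaluation carries the numerical content: both parities, all edges between two sites and
    all edges inside a cluster. *)
Lemma certified_all :
  all (fun b => all (fun s => all (fun t =>
    if (s < t) || (s == t) && (13 < s) then certified b s t else true)
  (iota 0 20)) (iota 0 20)) (iota 0 2).
Proof. by vm_compute. Qed.

Lemma certificate (b s t : nat) : b <= 1 -> s < 20 -> t < 20 -> s < t \/ s = t /\ 13 < s ->
  certified b s t.
Proof.
move=> b1 sl tl st; move: certified_all.
move=> /allP/(_ b); rewrite mem_iota => /(_ b1).
move=> /allP/(_ s); rewrite mem_iota => /(_ sl).
move=> /allP/(_ t); rewrite mem_iota => /(_ tl).
by case: st => [-> // | [-> ->]]; rewrite eqxx orbT.
Qed.

Lemma certified_bound b s t u k l : certified b s t ->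
  k \in corners s t -> l \in corners s t ->
  \sum_(e <- crossing_nodes s t)
    (evalf u (corner_form b s t k e.1) * evalf u (corner_form b s t l e.2) +
     evalf u (corner_form b s t l e.1) * evalf u (corner_form b s t k e.2))
  <= 2 * evalp u (limit b).
Proof.
move=> /allP/(_ k) + ks ls => /(_ ks)/allP/(_ l ls) /(evalp_le u).
rewrite evalp_add addnn -mul2n; apply: leq_trans; rewrite /corner_poly.
elim: (crossing_nodes s t) => [|e E IH]; first by rewrite big_nil.
by rewrite big_cons /= !evalp_add !evalp_mul leq_add2l.
Qed.

(** * Vertex classes relative to a fixed edge *)

Definition same_order (a b c d : nat * nat) :=
  a.1 == b.1 -> (a.2 < b.2) = (c.2 < d.2).

(** [chi] uses indices only to compare vertices of a common site, so indices may be replaced by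
    ranks. *)
Lemma chi_ext a b c a' b' c' : a.1 = a'.1 -> b.1 = b'.1 -> c.1 = c'.1 ->
  same_order a b a' b' -> same_order b c b' c' -> same_order c a c' a' ->
  chi a b c = chi a' b' c'.
Proof.
move=> a1 b1 c1; rewrite /same_order /chi -a1 -b1 -c1.
case: eqVneq => [ab|ab]; case: eqVneq => [bc|bc].
- by rewrite -bc -ab eqxx => -> // -> // ->.
- by move=> ->.
- by move=> _ ->.
- by case: eqVneq => // ca _ _ ->.
Qed.

Section Classes.
Variables (b u : nat).

Definition site_size (s : nat) := evalf u (size_form b s).

Definition vertex : finType := {s : 'I_20 & 'I_(site_size s)}.
Definition key (w : vertex) : nat * nat := (tag w : nat, tagged w : nat).
Arguments key : simpl never.

Lemma key_inj : injective key.
Proof.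
case=> [s i] [t j] [] /= /val_inj st; case: t / st j => j ij.
by congr existT; apply: val_inj.
Qed.

Lemma key_lt w : ((key w).1 < 20) * ((key w).2 < site_size (key w).1).
Proof. by case: w => s i /=; rewrite !ltn_ord. Qed.

Lemma site_size_room s : site_size s = (evalf u (room_form b s)).+1.
Proof.
by rewrite /site_size /room_form /size_form /evalf; case: (s < 14) => /=; [lia | case: (s < 17) => /=; lia].
Qed.

Lemma room_single s : s < 14 -> evalf u (room_form b s) = 0.
Proof. by rewrite /evalf /room_form /size_form => ->. Qed.

Lemma site_class_card s (P : pred nat) lo hi :
  (forall i, i < site_size s -> P i -> lo <= i < hi) ->
  #|[set w : vertex | ((key w).1 == s) && P (key w).2]| <= hi - lo.
Proof.
move=> P_int.
have -> : hi - lo = size [seq (s, i) | i <- iota lo (hi - lo)].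
  by rewrite size_map size_iota.
rewrite cardE -(size_map key); apply: uniq_leq_size.
  by rewrite map_inj_uniq ?enum_uniq //; apply: key_inj.
move=> _ /mapP[w + ->]; rewrite mem_enum inE => /andP[/eqP ws Pw].
have [_ w_lt] := key_lt w; rewrite ws in w_lt.
have /andP[lo_i i_hi] := P_int _ w_lt Pw.
apply/mapP; exists (key w).2; last by rewrite -ws; case: (key w).
by rewrite mem_iota lo_i subnKC //; lia.
Qed.

(** This is [3 * k + 8] for [k = 2 * u + 4 + b]. *)
Lemma vertex_card : #|{: vertex}| = 14 + 3 * u.+1 + 3 * (u.+1 + b).
Proof.
rewrite card_tagged sumnE big_map big_enum /=.
under eq_bigr do rewrite card_ord.
by rewrite !big_ord_recr big_ord0 /= /site_size /evalf /=; lia.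
Qed.

Section Edge.
Variables (p q : vertex) (s i t j : nat).
Hypotheses (key_p : key p = (s, i)) (key_q : key q = (t, j)).
Hypothesis p_lt_q : s < t \/ s = t /\ i < j.

Lemma idx_lt : i < site_size s /\ j < site_size t.
Proof. by have := key_lt p; have := key_lt q; rewrite key_p key_q => -[_ ->] [_ ->]. Qed.

(** Each pair of comparisons adds 0 before, 1 at and 2 after an end; for [s = t] both pairs
    contribute, giving ranks 0 to 4. *)
Definition node (w : nat * nat) : nat * nat :=
  (w.1, (w.1 == s) * ((i <= w.2) + (i < w.2)) + (w.1 == t) * ((j <= w.2) + (j < w.2))).

Lemma node_p : node (key p) = (end_nodes s t).1.
Proof.
rewrite key_p /node /end_nodes /= eqxx; congr pair.
by have [st|st] := eqVneq s t; lia.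
Qed.

Lemma node_q : node (key q) = (end_nodes s t).2.
Proof.
rewrite key_q /node /end_nodes /= eqxx; congr pair.
by rewrite eq_sym; have [st|st] := eqVneq s t; lia.
Qed.

Lemma node_ends w : node (key w) \in [:: node (key p); node (key q)] ->
  w \in [set p; q].
Proof.
have key_eq v : (key w).1 = (key v).1 -> (key w).2 = (key v).2 -> w = v.
  by move=> e1 e2; apply: key_inj; case: (key w) (key v) e1 e2 => [? ?] [? ?] /= -> ->.
rewrite node_p node_q /end_nodes /node !inE !xpair_eqE.
move=> /orP[] /andP[/eqP ws]; rewrite ws eqxx => rk.
  rewrite [w](_ : _ = p) ?eqxx //; apply: key_eq; rewrite key_p //; rewrite [RHS]/=.
  by move: rk; have [st|st] := eqVneq s t; lia.
rewrite [w](_ : _ = q) ?eqxx ?orbT //; apply: key_eq; rewrite key_q //; rewrite [RHS]/=.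
by move: rk; rewrite (eq_sym t); have [st|st] := eqVneq s t; lia.
Qed.

(** Within a site the rank is nondecreasing in the index, so distinct ranks are ordered like the
    indices. *)
Lemma node_order a c : node a != node c -> same_order a c (node a) (node c).
Proof.
move=> + /eqP ac; rewrite /node ac xpair_eqE eqxx /=.
by move: (c.1 == s) (c.1 == t) => [] []; lia.
Qed.

(* Otherwise [simpl] enumerates all sites. *)
Arguments nodes : simpl never.
Arguments crossing_nodes : simpl never.

Lemma node_mem w : w \notin [set p; q] -> node (key w) \in nodes s t.
Proof.
move=> wpq; have [w20 _] := key_lt w.
have {wpq} : node (key w) \notin [:: node (key p); node (key q)].
  by apply: contra wpq; apply: node_ends.
rewrite node_p node_q /end_nodes /nodes mem_cat.
have [wst|] := boolP (((key w).1 != s) && ((key w).1 != t)).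
  move=> _; apply/orP; left; apply/mapP; exists (key w).1.
    by rewrite mem_filter wst mem_iota.
  by case/andP: wst => /negPf ws /negPf wt; rewrite /node ws wt.
rewrite negb_and !negbK /node => wst rk; apply/orP; right.
move: rk; have [st|st] := eqVneq s t; rewrite ?st !inE !xpair_eqE.
  rewrite st orbb in wst; rewrite wst /=.
  by case: p_lt_q; lia.
case/orP: wst => /eqP ->; rewrite ?eqxx ?(negPf st) 1?eq_sym ?(negPf st) /=; lia.
Qed.

Definition class_size (c : nat * nat) := #|[set w : vertex | node (key w) == c]|.

Definition class_bound (c : nat * nat) : nat :=
  if s == t then
    if c.1 == s then
      if c.2 == 0 then i else if c.2 == 2 then j - i.+1 else site_size s - j.+1
    else site_size c.1
  else if c.1 == s then if c.2 == 0 then i else site_size s - i.+1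
  else if c.1 == t then if c.2 == 0 then j else site_size t - j.+1
  else site_size c.1.

(** The parts of a split cluster are index intervals. Upper bounds suffice, since the quadratic form
    has nonnegative coefficients. *)
Lemma class_size_le c : c \in nodes s t -> class_size c <= class_bound c.
Proof.
have bound lo hi :
    (forall x, x < site_size c.1 -> (node (c.1, x)).2 = c.2 -> lo <= x < hi) ->
    class_size c <= hi - lo.
  move=> H; apply: leq_trans (@site_class_card c.1
    (fun x => (node (c.1, x)).2 == c.2) lo hi _); last first.
    by move=> x xs /eqP; apply: H.
  apply: subset_leq_card; apply/fintype.subsetP => w; rewrite !inE => /eqP <-.
  by rewrite eqxx /node /=.
have [i_lt j_lt] := idx_lt.
rewrite mem_cat => /orP[/mapP[d + cE]|].
  rewrite mem_filter => /andP[/andP[/negPf ds /negPf dt] _].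
  rewrite /class_bound [in leqRHS]cE /= ds dt !if_same -[leqRHS]subn0.
  by rewrite -[d]/((d, 0).1) -cE; apply: bound => x -> _.
have ends lo hi : c.1 = s \/ c.1 = t ->
    (forall x, x < site_size c.1 ->
      (c.1 == s) * ((i <= x) + (i < x)) + (c.1 == t) * ((j <= x) + (j < x)) = c.2 ->
      lo <= x < hi) -> hi - lo = class_bound c -> class_size c <= class_bound c.
  by move=> _ H <-; apply: bound.
have [st|st] := eqVneq s t; rewrite !inE.
  have ij : i < j by case: p_lt_q => [|[]//]; rewrite st ltnn.
  case/or3P => /eqP cE.
  - apply: (ends 0 i); rewrite /class_bound cE /=; rewrite -?st ?eqxx; [by left|lia|lia].
  - apply: (ends i.+1 j); rewrite /class_bound cE /=; rewrite -?st ?eqxx; [by left|lia|lia].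
  - apply: (ends j.+1 (site_size s)); rewrite /class_bound cE /=; rewrite -?st ?eqxx; [by left|lia|lia].
have ts : (t == s) = false by apply/negbTE; rewrite eq_sym.
case/or4P => /eqP cE.
- apply: (ends 0 i); rewrite /class_bound cE /=; rewrite ?eqxx ?(negPf st) ?ts; [by left|lia|lia].
- apply: (ends i.+1 (site_size s)); rewrite /class_bound cE /=; rewrite ?eqxx ?(negPf st) ?ts; [by left|lia|lia].
- apply: (ends 0 j); rewrite /class_bound cE /=; rewrite ?eqxx ?(negPf st) ?ts; [by right|lia|lia].
- apply: (ends j.+1 (site_size t)); rewrite /class_bound cE /=; rewrite ?eqxx ?(negPf st) ?ts; [by right|lia|lia].
Qed.

(* The summand [m == 1] keeps the total weight positive when the vertex is alone
   at its site. *)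
Definition end_weight (m x r : nat) : nat :=
  if r == 0 then x + (m == 1) else m - x.+1.

Lemma end_weight_gt0 m x : x < m -> 0 < end_weight m x 0 + end_weight m x 2.
Proof. by rewrite /end_weight /=; lia. Qed.

(** For [m > 1] the two weights add up to [m.-1] and equality holds; for [m = 1] both sides
    vanish. *)
Lemma end_weight_before m x : x < m ->
  (end_weight m x 0 + end_weight m x 2) * x <= end_weight m x 0 * m.-1.
Proof.
rewrite /end_weight /= => xm; have [m1|m1] := eqVneq m 1; first by nia.
by rewrite addn0 mulnC leq_mul2l; apply/orP; right; lia.
Qed.

Lemma end_weight_after m x : x < m ->
  (end_weight m x 0 + end_weight m x 2) * (m - x.+1) <= end_weight m x 2 * m.-1.
Proof.
rewrite /end_weight /= => xm; have [m1|m1] := eqVneq m 1; first by nia.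
by rewrite addn0 mulnC leq_mul2l; apply/orP; right; lia.
Qed.

(** For [s == t] the three parts hold one vertex fewer than the room; [i.+1] in place of [i] brings
    the total weight to [(site_size s).-1]. Otherwise the two sites split independently, hence the
    product. *)
Definition corner_weight (k : nat * nat) : nat :=
  if s == t then
    if k.1 == 0 then i.+1 else if k.1 == 2 then j - i.+1 else site_size s - j.+1
  else end_weight (site_size s) i k.1 * end_weight (site_size t) j k.2.

Lemma room_size c : evalf u (room_form b c) = (site_size c).-1.
Proof. by rewrite site_size_room. Qed.

Lemma corner_weight_gt0 : 0 < \sum_(k <- corners s t) corner_weight k.
Proof.
have [i_lt j_lt] := idx_lt; rewrite /corners /corner_weight.
case: eqVneq => [st|st]; rewrite !big_cons big_nil //= addn0.
rewrite addnA -mulnDr -mulnDr -mulnDl muln_gt0.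
by rewrite !end_weight_gt0.
Qed.

(** An unsplit class has the same size at every corner. For a part of a split cluster, only the
    corners where that part is full contribute. *)
Lemma class_bound_mixture c : c \in nodes s t ->
  (\sum_(k <- corners s t) corner_weight k) * class_bound c <=
  \sum_(k <- corners s t) corner_weight k * evalf u (corner_form b s t k c).
Proof.
have [i_lt j_lt] := idx_lt; have ev0 : evalf u (0, 0) = 0 by [].
have other d : d != s -> d != t -> c = (d, 0) ->
    (\sum_(k <- corners s t) corner_weight k) * class_bound c <=
    \sum_(k <- corners s t) corner_weight k * evalf u (corner_form b s t k c).
  move=> /negPf ds /negPf dt ->; rewrite /class_bound /corner_form /= ds dt if_same.
  by rewrite big_distrl.
rewrite mem_cat => /orP[/mapP[d + cE]|].
  by rewrite mem_filter => /andP[/andP[ds dt] _]; apply: other cE.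
rewrite /corners /class_bound /corner_form /corner_weight {other}.
have [st|st] := eqVneq s t; rewrite !big_cons !big_nil !inE.
  have ij : i < j by case: p_lt_q => [|[]//]; rewrite st ltnn.
  rewrite -st in j_lt; rewrite !addn0.
  case/or3P => /eqP -> /=; rewrite eqxx /= room_size ?ev0 ?muln0 ?addn0 ?add0n;
    move: (site_size s) j_lt => m j_lt; rewrite [leqRHS]mulnC -?[m.-1 * _]mulnC;
    apply: leq_trans (leq_mul (_ : _ <= m.-1) (leqnn _)) _; lia.
have ts : (t == s) = false by apply/negbTE; rewrite eq_sym.
case/or4P => /eqP -> /=; rewrite ?eqxx ?ts /= room_size ?ev0 ?muln0 ?addn0 ?add0n;
  (* The total weight factors over the two sites; cancelling the factor of the other site leaves an
     inequality about one cluster. *)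
  rewrite addnA -mulnDr -mulnDr -mulnDl ?addnA.
- rewrite -mulnDl -mulnDr.
  rewrite mulnAC [leqRHS]mulnAC leq_mul2r end_weight_before ?orbT //.
- rewrite -mulnDl -mulnDr.
  rewrite mulnAC [leqRHS]mulnAC leq_mul2r end_weight_after ?orbT //.
- rewrite -mulnDl -mulnDl -mulnA -[leqRHS]mulnA leq_mul2l end_weight_before ?orbT //.
- rewrite -mulnDl -mulnDl -mulnA -[leqRHS]mulnA leq_mul2l end_weight_after ?orbT //.
Qed.

Definition chiv (x y z : vertex) := chi (key x) (key y) (key z).

(** The vertices involved have pairwise distinct nodes wherever [chi] is evaluated, so their nodes
    have the same orientations. *)
Lemma separated_nodes w : w \in separated_pairs chiv p q ->
  (node (key w.1), node (key w.2)) \in crossing_nodes s t.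
Proof.
case: w => w z; rewrite inE /= => /and5P[wpq zpq cw cz sep].
have pq : p != q.
  by apply/eqP => pq; move: key_q; rewrite -pq key_p => -[e1 e2]; case: p_lt_q; lia.
have npq : node (key p) != node (key q).
  apply/eqP => /(congr1 (fun n => n \in [:: node (key p); node (key p)])).
  rewrite node_p node_q /end_nodes !inE !xpair_eqE !eqxx orbb /=.
  by have [st|st] := eqVneq s t.
have ends v : v \notin [set p; q] ->
    (node (key v) != node (key p)) * (node (key v) != node (key q)).
  move=> vpq; have : node (key v) \notin [:: node (key p); node (key q)].
    by apply: contra vpq; apply: node_ends.
  by rewrite !inE negb_or => /andP[-> ->].
have [wp wq] := ends w wpq; have [zp zq] := ends z zpq.
have chi_node (x y v : vertex) : node (key x) != node (key y) ->
    node (key y) != node (key v) -> node (key v) != node (key x) ->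
    chiv x y v = chi (node (key x)) (node (key y)) (node (key v)).
  by move=> *; apply: chi_ext => //; apply: node_order.
rewrite (chi_node p q w) // 1?eq_sym // in cw.
rewrite (chi_node p q z) // 1?eq_sym // in cz.
(* The two vertices lie on opposite sides of the edge. *)
have wz : node (key w) != node (key z).
  by apply: contraTneq cw => ->.
rewrite (chi_node w z p) // 1?(eq_sym (node (key p))) // in sep.
rewrite (chi_node w z q) // 1?(eq_sym (node (key q))) // in sep.
rewrite /crossing_nodes -node_p -node_q mem_filter sep /=.
by apply: allpairs_f; rewrite mem_filter ?cw ?cz node_mem.
Qed.

(** Double counting: every separated pair is charged to its pair of classes, and a pair of classes
    receives at most the product of their sizes. *)
Lemma separated_pairs_le :
  #|separated_pairs chiv p q| <=
  \sum_(e <- crossing_nodes s t) class_size e.1 * class_size e.2.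
Proof.
rewrite -sum1_card.
apply: (@leq_trans (\sum_(w : vertex * vertex) \sum_(e <- crossing_nodes s t)
    ((node (key w.1) == e.1) && (node (key w.2) == e.2) : nat))).
  rewrite big_mkcond /=; apply: leq_sum => w _; case: ifP => // /separated_nodes w_in.
  by rewrite (big_rem _ w_in) /= !eqxx leq_addr.
rewrite exchange_big /=; apply: leq_sum => e _.
rewrite -big_mkcond /= sum1_card /class_size -cardsX.
apply: subset_leq_card; apply/fintype.subsetP => w; rewrite !inE.
by case: w => w z.
Qed.

Lemma separated_pairs_limit : certified b s t ->
  #|separated_pairs chiv p q| <= evalp u (limit b).
Proof.
move=> cert; apply: leq_trans separated_pairs_le _.
have nodes_in e : e \in crossing_nodes s t -> (e.1 \in nodes s t) * (e.2 \in nodes s t).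
  rewrite mem_filter => /andP[_ /allpairsP[c [c1 c2 ->]]] /=.
  by move: c1 c2; rewrite !mem_filter => /andP[_ ->] /andP[_ ->].
apply: (@leq_trans (\sum_(e <- crossing_nodes s t) class_bound e.1 * class_bound e.2)).
  rewrite big_seq [leqRHS]big_seq; apply: leq_sum => e /nodes_in[e1 e2].
  by rewrite leq_mul ?class_size_le.
apply: (mixture_bound corner_weight_gt0 (V := fun k c => evalf u (corner_form b s t k c))).
  by move=> e /nodes_in[e1 e2]; split; apply: class_bound_mixture.
by move=> k l; apply: certified_bound.
Qed.
End Edge.

End Classes.

End Counting.

(** * The drawing and the final bound *)

Lemma rectilinear_lcr_vertex (R : realType) (b u : nat) : (b <= 1)%N ->
  (rectilinear_lcr R #|{: vertex b u}| <= evalp u (limit b))%N.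
Proof.
(* No site has more than [u.+2] vertices, so [N = u.+2] accommodates all indices. *)
move=> b1; have size_le s : (site_size b u s <= u.+2)%N.
  by rewrite /site_size /size_form /evalf; case: ifP => _ /=; [|case: ifP => _ /=]; lia.
have valid_key (w : vertex b u) : valid u.+2 (key w).
  have := key_lt w; case: (key w) => s i [/= s20 i_lt].
  apply/and3P; split=> //=; first by have := size_le s; lia.
  by case: leqP => //= s14; move: i_lt; rewrite site_size_room (room_single _ _ s14) ltnS leqn0.
have sgn (x y z : vertex b u) : x != y -> y != z -> z != x ->
    (area (place R u.+2 (key x)) (place R u.+2 (key y)) (place R u.+2 (key z)) != 0) *
    ((0 < area (place R u.+2 (key x)) (place R u.+2 (key y)) (place R u.+2 (key z)))
     = chiv x y z).
  by move=> xy yz zx; apply: area_place; rewrite ?(inj_eq (@key_inj b u)).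
apply: (@rectilinear_lcr_le R _ (fun w => place R u.+2 (key w)) (@chiv b u)).
- by rewrite vertex_card; lia.
- by move=> x y z xy yz zx; have [] := sgn x y z xy yz zx.
- by move=> x y z xy yz zx; have [] := sgn x y z xy yz zx.
have ordered (x y : vertex b u) s i t j : key x = (s, i) -> key y = (t, j) ->
    (s < t \/ s = t /\ i < j)%N ->
    (#|separated_pairs (@chiv b u) x y| <= evalp u (limit b))%N.
  move=> kx ky xy; apply: (separated_pairs_limit kx ky xy).
  have [s20 i_lt] := key_lt x; have [t20 j_lt] := key_lt y.
  rewrite kx ky /= in s20 i_lt t20 j_lt.
  apply: certificate => //; case: xy => [|[st ij]]; [by left | right; split=> //].
  (* A site with a single vertex forces [j = 0], against [i < j]. *)
  rewrite ltnNge; apply/negP => s13; move: j_lt; rewrite -st site_size_room (room_single _ _ s13).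
  by move: ij; clear; lia.
move=> x y xy; case kx: (key x) => [s i]; case ky: (key y) => [t j].
case: (ltngtP s t) => st.
- by left; apply: ordered kx ky _; left.
- by right; apply: ordered ky kx _; left.
case: (ltngtP i j) => ij.
- by left; apply: ordered kx ky _; right.
- by right; apply: ordered ky kx _; right.
by case/eqP: xy; apply: key_inj; rewrite kx ky st ij.
Qed.

Lemma floor_half (R : realType) (k : nat) : Num.floor (k%:R / 2%:R : R) = k./2%:Z.
Proof.
have -> : k%:R = (odd k)%:R + (k./2)%:R * 2 :> R.
  by rewrite -{1}[k]odd_double_half -muln2 natrD natrM.
have : (odd k)%:R <= 1 :> R by rewrite (ler_nat R _ 1) leq_b1.
have : 0 <= (odd k)%:R :> R by rewrite ler0n.
move=> b0 b1; apply: floor_def; rewrite intrD -!pmulrn.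
by apply/andP; split; lra.
Qed.

Theorem theorem5 (R : realType) (n k : nat) (hk : (4 <= k)%N)
    (hn : n = (3 * k + 8)%N) :
  (rectilinear_lcr R n)%:R <=
    9%:R^-1 * (n%:R - 2%:R) ^+ 2
      - (Num.floor ((n%:R - 2%:R) / 6%:R : R))%:~R :> R
  /\ 9%:R^-1 * (n%:R - 2%:R) ^+ 2
      - (Num.floor ((n%:R - 2%:R) / 6%:R : R))%:~R
     = k%:R ^+ 2 + 4%:R * k%:R + 3%:R
      - (Num.floor (k%:R / 2%:R : R))%:~R :> R.
Proof.
(* Hence the square term is [(k + 2) ^ 2], and the floor is that of [k / 2] plus 1. *)
have nE : n%:R - 2 = 3 * (k + 2)%:R :> R by rewrite hn (natrD _ (3 * k)) (natrM _ 3) natrD; ring.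
have -> : (n%:R - 2%:R) / 6%:R = (k + 2)%:R / 2%:R :> R by rewrite nE; field.
have second : 9%:R^-1 * (n%:R - 2%:R) ^+ 2 - (Num.floor ((k + 2)%:R / 2%:R : R))%:~R
    = k%:R ^+ 2 + 4%:R * k%:R + 3%:R - (Num.floor (k%:R / 2%:R : R))%:~R :> R.
  rewrite nE !floor_half -!pmulrn addn2 /= -[k.+2]addn2 -[k./2.+1]addn1 !natrD.
  by field.
split=> //; rewrite {}second floor_half.
(* Since [4 <= k], the truncated subtraction is exact and [u] is the parameter of the size forms. *)
pose b : nat := odd k; pose u := (k - 4)./2.
have kE : k = (2 * u + 4 + b)%N by rewrite /u /b; lia.
have -> : n = #|{: vertex b u}| by rewrite vertex_card hn; lia.
have half : k./2 = (u + 2)%N by rewrite /u; lia.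
apply: (@le_trans _ _ (evalp u (limit b))%:R).
  by rewrite ler_nat rectilinear_lcr_vertex // leq_b1.
(* The certified limit equals the claimed value exactly; moving [k./2] to the left avoids truncated
   subtraction. *)
have limitE : (evalp u (limit b) + k./2 = k ^ 2 + 4 * k + 3)%N.
  rewrite half kE /b; case: (odd k); rewrite /evalp /limit /=; nia.
by rewrite lerBrDr -pmulrn -natrD limitE (natrD _ (k ^ 2 + 4 * k)) (natrD _ (k ^ 2)) natrX natrM.
Qed.
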